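(* Let $C$ be a real symmetric $k\times k$ circulant matrix, let $\alpha,\beta$ be two arbitrary real numbers, and let $\epsilon\in\mathbb{R}$. Consider the $2k\times 2k$ matrix $$A=\begin{pmatrix} C & [\alpha]_{k,k}\\ [\beta]_{k,k} & C\end{pmatrix},$$ where $[\alpha]_{k,k}$ (resp. $[\beta]_{k,k}$) is the $k\times k$ matrix all of whose entries equal $\alpha$ (resp. $\beta$). For each $1\le j\le k-1$ and any $\phi\in[0,2\pi)$, let $$\theta_0^{(j,\phi)}=\left(0,\frac{2\pi j}{k},\dots,\frac{2\pi(k-1)j}{k},\ \phi,\ \frac{2\pi j}{k}+\phi,\dots,\frac{2\pi(k-1)j}{k}+\phi\right)^T.$$ Then: (1) $\theta_0^{(j,\phi)}$ is an equilibrium point of the complex-valued Kuramoto model with adjacency matrix $A$ and coupling strength $\epsilon$; (2) $\theta_0^{(j,\phi)}$ is also an equilibrium point of the original Kuramoto model with adjacency matrix $A$.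
   Context: Here $\mathbf{i}=\sqrt{-1}$, and exponentials and arguments of vectors are taken entrywise. Let $A=(a_{ij})$ be a real $N\times N$ matrix (the weighted adjacency matrix). Original Kuramoto model (zero natural frequencies): $\frac{d\theta_i}{dt}=\epsilon\sum_{j=1}^N a_{ij}\sin(\theta_j-\theta_i)$, $1\le i\le N$. A point $\theta_0=(\theta_1,\dots,\theta_N)\in\mathbb{R}^N$ is an equilibrium point of it if $\sum_{j=1}^N a_{ij}\sin(\theta_j-\theta_i)=0$ for all $1\le i\le N$. Complex-valued Kuramoto model: $\frac{d\theta_i}{dt}=\epsilon\sum_{j=1}^N a_{ij}\left[\sin(\theta_j-\theta_i)-\mathbf{i}\cos(\theta_j-\theta_i)\right]$ with $\theta_i\in\mathbb{C}$; under $x=e^{\mathbf{i}\theta}$ it becomes $\frac{dx}{dt}=\epsilon Ax$, with solution $x(t)=e^{\epsilon tA}x(0)$. A real vector $\theta_0$ is an equilibrium point of it if, with $x_0=e^{\mathbf{i}\theta_0}$, for all $t\ge0$ one has $\arg(e^{\epsilon tA}x_0)=\arg(x_0)=\theta_0$, arguments being understood modulo $2\pi$ (in particular every entry of $e^{\epsilon tA}x_0$ is nonzero). *)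

(* Defs.v *)
From mathcomp Require Import all_boot all_order all_algebra.
From mathcomp Require Import all_classical all_reals all_analysis.
From mathcomp Require Import complex.
Import Order.TTheory GRing.Theory Num.Theory.
Import numFieldNormedType.Exports.

Set Implicit Arguments.
Unset Strict Implicit.
Unset Printing Implicit Defensive.

Local Open Scope classical_set_scope.
Local Open Scope ring_scope.
Local Open Scope complex_scope.

(* The series converges for every M in the (entrywise) topology of 'M[R]_n, so
   the default value taken by limn on divergent sequences is never used. *)
Definition expmx (R : realType) (n : nat) (M : 'M[R]_n) : 'M[R]_n :=
  limn (series (fun m : nat => (m`!%:R)^-1 *: M ^+ m)).

(* e^(i theta) for real theta. *)
Definition cexpi (R : realType) (theta : R) : R[i] := cos theta +i* sin theta.

(* The argument modulo 2 pi is the set of all its real representatives; for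
   z != 0 it is a coset of 2 pi Z, and the argument of 0 is the empty set. *)
Definition carg (R : realType) (z : R[i]) : set R :=
  [set theta | z != 0 /\ z = `|z| * cexpi theta].

Definition kuramoto_equilibrium (R : realType) (N : nat)
    (A : 'M[R]_N) (theta : 'cV[R]_N) : Prop :=
  forall i : 'I_N, \sum_(j < N) A i j * sin (theta j 0 - theta i 0) = 0.

(* Under x = e^(i theta), the complex-valued model with coupling strength eps
   becomes x' = eps A x, whose solution is x t = e^(eps t A) (x 0).  The second
   conjunct makes the right-hand side of the first one nonempty, hence every
   entry of the solution is nonzero. *)
Definition complex_kuramoto_equilibrium (R : realType) (N : nat)
    (A : 'M[R]_N) (eps : R) (theta : 'cV[R]_N) : Prop :=
  let x0 := map_mx (@cexpi R) theta in
  forall t : R, 0 <= t -> forall i : 'I_N,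
    carg ((map_mx (real_complex R) (expmx ((eps * t) *: A)) *m x0) i 0)
      = carg (x0 i 0)
    /\ carg (x0 i 0) (theta i 0).

(* Entry (i, j) is c_(j - i mod k); truncated subtraction is harmless as i < k. *)
Definition circulant_mx (R : realType) (k : nat) (c : nat -> R) : 'M[R]_k :=
  \matrix_(i < k, j < k) c ((j + (k - i)) %% k)%N.

Definition is_circulant (R : realType) (k : nat) (C : 'M[R]_k) : Prop :=
  exists c : nat -> R, C = circulant_mx k c.

Definition twisted_state (R : realType) (k j : nat) (phi : R) :
    'cV[R]_(k + k) :=
  col_mx (\col_(l < k) (2 * pi * l%:R * j%:R / k%:R))
         (\col_(l < k) (2 * pi * l%:R * j%:R / k%:R + phi)).

(* Main.v *)
Require Import Defs.
From mathcomp Require Import all_boot all_order all_algebra.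
From mathcomp Require Import all_classical all_reals all_analysis.
From mathcomp Require Import complex ring lra.
Import Order.TTheory GRing.Theory Num.Theory.
Import numFieldNormedType.Exports.

Local Open Scope ring_scope.
Local Open Scope classical_set_scope.

(** With a = 2 pi j / k, every phase-shifted wave l |-> cos (a l + psi) is an
    eigenvector of the symmetric circulant block C for one real eigenvalue
    lambda that does not depend on psi, and its entries sum to 0, so the constant
    blocks annihilate it.  Hence cos theta0 and sin theta0 (the shifts psi = 0 and
    psi = - pi / 2) are eigenvectors of A for lambda.  Then e^(s A) multiplies
    e^(i theta0) by e^(s lambda) > 0, which preserves arguments, and
    sum_l A_il sin (theta_l - theta_i)
      = lambda (sin theta_i cos theta_i - cos theta_i sin theta_i) = 0. *)

(** * Convergence of the matrix exponential and its action on eigenvectors *)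

Lemma cvg_mx_entries (R : realType) (m n : nat) (u : nat -> 'M[R]_(m, n))
    (L : 'M[R]_(m, n)) :
  (forall i j, ((fun p => u p i j) @ \oo --> L i j)%classic) ->
  (u @ \oo --> L)%classic.
Proof.
move=> uL A [P LP PA]; apply: filterS PA _.
change (\forall p \near \oo, forall i j, P i j (u p i j)).
apply: filter_forall => i; apply: filter_forall => j.
by apply: (uL i j); exact: LP.
Qed.

(** The sum of the absolute values of all entries is a submultiplicative bound. It lets a scalar
    exponential series dominate each entry of the matrix series. *)
Lemma mx_power_entry_le (R : realType) (n : nat) (M : 'M[R]_n) (m : nat) i j :
  `|(M ^+ m) i j| <= (\sum_k \sum_l `|M k l|) ^+ m.
Proof.
set b := \sum_k _.
have b0 : 0 <= b by apply: sumr_ge0 => k _; apply: sumr_ge0.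
elim: m j => [|m IHm] j.
  by rewrite !expr0 mxE; case: (_ == _); rewrite ?normr1 ?normr0.
rewrite !exprSr mxE (le_trans (ler_norm_sum _ _ _))//.
apply: (@le_trans _ _ (\sum_l b ^+ m * `|M l j|)).
  by apply: ler_sum => l _; rewrite normrM ler_wpM2r.
rewrite -mulr_sumr ler_wpM2l ?exprn_ge0//; apply: ler_sum => k _.
by rewrite (bigD1 j)//= lerDl sumr_ge0.
Qed.

(** Each entry converges absolutely by comparison with a scalar exponential series, so [expmx] is a
    genuine limit. *)
Lemma cvg_expmx (R : realType) (n : nat) (M : 'M[R]_n) :
  (series (fun m : nat => (m`!%:R)^-1 *: M ^+ m) @ \oo --> expmx M)%classic.
Proof.
pose e i j := fun m : nat => (m`!%:R)^-1 * (M ^+ m) i j.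
have ecvg i j : cvgn (series (e i j)).
  set b := \sum_k \sum_l `|M k l|.
  apply: normed_cvg; apply: (series_le_cvg _ _ _ (is_cvg_series_exp_coeff b)).
  - by move=> m /=.
  - move=> m; apply: exp_coeff_ge0.
    by apply: sumr_ge0 => k _; apply: sumr_ge0.
  - move=> m; rewrite /e /exp_coeff /= normrM mulrC [`|_^-1|]ger0_norm ?invr_ge0//.
    by rewrite ler_wpM2r ?invr_ge0// mx_power_entry_le.
have : (series (fun m : nat => (m`!%:R)^-1 *: M ^+ m) @ \oo -->
          \matrix_(i, j) limn (series (e i j)))%classic.
  apply: cvg_mx_entries => i j; rewrite mxE.
  have -> : (fun p => series (fun m : nat => (m`!%:R)^-1 *: M ^+ m) p i j)
            = series (e i j); last exact: ecvg.
  by apply/funext => p; rewrite /series/= summxE; apply: eq_bigr => m _; rewrite mxE.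
move=> h; have h2 := cvg_lim (@norm_hausdorff _ _) h.
by rewrite /expmx h2.
Qed.

Lemma mulmx_exp_eigen (R : comNzRingType) (n : nat) (M : 'M[R]_n) (u : 'cV[R]_n)
    (lambda : R) (m : nat) :
  M *m u = lambda *: u -> M ^+ m *m u = lambda ^+ m *: u.
Proof.
move=> Mu; elim: m => [|m IHm]; first by rewrite !expr0 mul1mx scale1r.
by rewrite exprSr -mulmxA Mu -scalemxAr IHm scalerA exprS.
Qed.

(** A partial sum applied to [u] is a scalar partial sum times [u]; both sides are limits of this
    one sequence, and limits are unique. *)
Lemma expmx_eigen (R : realType) (n : nat) (M : 'M[R]_n) (u : 'cV[R]_n)
    (lambda : R) :
  M *m u = lambda *: u -> expmx M *m u = expR lambda *: u.
Proof.
move=> Mu; apply/colP => i; rewrite mxE [RHS]mxE.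
set S := series (fun m : nat => (m`!%:R)^-1 *: M ^+ m).
have SE p : \sum_j S p i j * u j 0 = series (exp_coeff lambda) p * u i 0.
  transitivity ((S p *m u) i 0); first by rewrite mxE.
  rewrite /S /series/= mulmx_suml summxE mulr_suml; apply: eq_bigr => m _.
  rewrite -scalemxAl (mulmx_exp_eigen _ _ _ _ _ _ Mu) !mxE /exp_coeff /=; ring.
apply: (@cvg_unique _ (@norm_hausdorff _ _)
  ((fun p => \sum_j S p i j * u j 0) @ \oo)%classic).
  apply: cvg_big => [|j _]; first exact: add_continuous.
  apply: cvgMr_tmp.
  by apply: (cvg_comp _ (fun N : 'M[R]_n => N i j) (@cvg_expmx R n M));
    exact: coord_continuous.
under [X in (X @ _)%classic]eq_fun do rewrite SE.
by apply: cvgMr_tmp; exact: is_cvg_series_exp_coeff.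
Qed.

(** * Arguments of complex numbers *)

Lemma cexpi_neq0 (R : realType) (theta : R) : cexpi theta != 0.
Proof.
apply/eqP => -[c0 s0]; have := cos2Dsin2 theta.
by rewrite c0 s0 expr0n addr0 => /esym/eqP; rewrite oner_eq0.
Qed.

Lemma norm_cexpi (R : realType) (theta : R) : `|cexpi theta| = 1.
Proof. by rewrite normc_def /= cos2Dsin2 sqrtr1. Qed.

Lemma carg_cexpi (R : realType) (theta : R) : carg (cexpi theta) theta.
Proof. by split; rewrite ?cexpi_neq0// norm_cexpi mul1r. Qed.

Lemma carg_scale (R : realType) (r : R) (z : R[i]) :
  0 < r -> carg (r%:C%C * z) = carg z.
Proof.
move=> r0; have rC0 : r%:C%C != 0 by rewrite eq_complex /= eqxx andbT gt_eqF.
rewrite /carg; apply/funext => theta /=; apply/propext.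
rewrite mulf_eq0 (negPf rC0) /= normrM normc_def /= expr0n addr0 sqrtr_sqr.
rewrite gtr0_norm// -mulrA; split=> -[z0 zE]; split=> //; last by rewrite -zE.
exact: (mulfI rC0).
Qed.

(** * Cosine waves on the integers modulo k, and circulant matrices *)

Lemma cos_mod (R : realType) (k j : nat) (a psi : R) (l : nat) :
  a * k%:R = pi *+ 2 * j%:R ->
  cos (a * (l %% k)%:R + psi) = cos (a * l%:R + psi).
Proof.
move=> ak; rewrite [in RHS](divn_eq l k) natrD natrM.
have -> : a * ((l %/ k)%:R * k%:R + (l %% k)%:R) + psi =
   (a * (l %% k)%:R + psi) + (pi *+ 2) *+ (j * (l %/ k)).
  rewrite mulrnA -(mulr_natr _ j) -ak -mulr_natr; ring.
by rewrite (periodicn (@cosD2pi R)).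
Qed.

(** As a function of [psi], the sum [S] is invariant under shifts by [a]. The addition formulas then
    give 2 S = 2 cos a S, which forces S = 0. *)
Lemma sum_cos_eq0 (R : realType) (k j : nat) (a psi : R) :
  a * k%:R = pi *+ 2 * j%:R -> cos a != 1 ->
  \sum_(l < k) cos (a * l%:R + psi) = 0.
Proof.
move=> ak ca.
pose S psi := \sum_(l < k) cos (a * l%:R + psi).
have shift x : S (x + a) = S x.
  apply/eqP; rewrite -subr_eq0 /S -sumrB.
  rewrite -(big_mkord xpredT (fun l => cos (a * l%:R + (x + a)) - cos (a * l%:R + x))).
  have E l : cos (a * l%:R + (x + a)) = cos (a * l.+1%:R + x).
    by congr cos; rewrite -(natr1 l); ring.
  under eq_bigr do rewrite E.
  (* Only the terms at [k] and at 0 survive; they agree because [a * k%:R] is a multiple of 2 pi. *)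
  rewrite telescope_sumr// -(cos_mod _ _ _ _ _ k ak) modnn.
  by rewrite subrr.
have : S (psi + a) + S (psi - a) = 2 * cos a * S psi.
  rewrite /S -big_split mulr_sumr; apply: eq_bigr => l _ /=.
  by rewrite !addrA cosD cosB; ring.
rewrite shift -(shift (psi - a)) subrK => /eqP.
rewrite -subr_eq0 (_ : _ - _ = 2 * (1 - cos a) * S psi); last by ring.
by rewrite !mulf_eq0 pnatr_eq0 subr_eq0 [1 == _]eq_sym (negPf ca) => /eqP.
Qed.

(** By the half-angle formula, 1 - cos a is twice the square of [sin (a / 2)], and a / 2 lies
    strictly between 0 and pi. *)
Lemma cos_lt1 (R : realType) (a : R) : 0 < a < pi *+ 2 -> cos a < 1.
Proof.
move=> /andP[a0 api]; have -> : a = (a / 2) *+ 2 by rewrite mulr2n; lra.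
have sa : 0 < sin (a / 2) by apply: sin_gt0_pi; apply/andP; split; lra.
rewrite cos_mulr2n cos2sin2; have : 0 < sin (a / 2) ^+ 2 by rewrite exprn_gt0.
lra.
Qed.

(* Averaging the expansions of the sum along row l and along column l, which
   agree by symmetry, leaves only the even part cos (a m) of each coefficient. *)
Lemma circulant_cos_eigen (R : realType) (k j : nat) (C : 'M[R]_k) (a : R) :
  C^T = C -> is_circulant C -> a * k%:R = pi *+ 2 * j%:R ->
  exists lambda, forall psi (l : 'I_k),
    \sum_m C l m * cos (a * m%:R + psi) = lambda * cos (a * l%:R + psi).
Proof.
(* The reindexings below use the group structure of ['I_k.+1]; for k = 0 there is no index [l]. *)
case: k C => [|k] C CT [c Cc] ak.
  by exists 0 => psi [].
(* The eigenvalue is the cosine Fourier coefficient, at frequency [a], of the first row of [C]. *)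
exists (\sum_(m < k.+1) c m * cos (a * m%:R)) => psi l.
have E1 : \sum_m C l m * cos (a * m%:R + psi) =
          \sum_(m < k.+1) c m * cos (a * (m + l)%:R + psi).
  rewrite (reindex_inj (addIr l)); apply: eq_bigr => m _ /=.
  rewrite (cos_mod _ _ _ _ _ _ ak); congr (_ * _).
  rewrite Cc mxE; congr c.
  by rewrite modnDml -addnA subnKC ?modnDr ?modn_small// ltnW.
have E2 : \sum_m C l m * cos (a * m%:R + psi) =
          \sum_(m < k.+1) c m * cos (a * l%:R - a * m%:R + psi).
  rewrite (reindex_inj (subrI l)); apply: eq_bigr => m _ /=.
  (* By symmetry this is the entry in row [l - m] and column [l], whose offset is [m]. *)
  have -> : C l (l - m) = c m.
    rewrite -[C]CT mxE Cc mxE /=; congr c.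
    by rewrite -modnDmr; exact: (congr1 val (subKr l m)).
  congr (_ * _).
  transitivity (cos (a * (l + (k.+1 - m))%:R + psi)).
    by rewrite -[RHS](cos_mod _ _ _ _ _ _ ak) /= modnDmr.
  (* Writing [k.+1 - m] for - m adds [j] full turns to the angle. *)
  rewrite natrD natrB 1?ltnW// -[RHS](periodicn (@cosD2pi R) j).
  congr cos; rewrite -[_ *+ j]mulr_natr -ak; ring.
set X := \sum_m _ in E1 E2 *; set Y := \sum_(m < k.+1) _.
suff : X + X = Y * cos (a * l%:R + psi) + Y * cos (a * l%:R + psi) by lra.
rewrite {1}E1 E2 -big_split/= mulr_suml -big_split/=; apply: eq_bigr => m _.
rewrite (_ : a * (m + l)%:R + psi = (a * l%:R + psi) + a * m%:R); last first.
  by rewrite natrD; ring.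
rewrite (_ : a * l%:R - a * m%:R + psi = (a * l%:R + psi) - a * m%:R); last by ring.
by rewrite cosD cosB; ring.
Qed.

Lemma twisted_state_cos_eigen (R : realType) (k : nat) (C : 'M[R]_k)
    (alpha beta : R) (j : nat) (phi : R) :
  C^T = C -> is_circulant C -> (1 <= j <= k - 1)%N ->
  exists lambda, forall psi,
    let u := map_mx (fun x => cos (x + psi)) (twisted_state k j phi) in
    block_mx C (const_mx alpha) (const_mx beta) C *m u = lambda *: u.
Proof.
move=> CT Cc /andP[j1 jk].
pose a : R := pi *+ 2 * j%:R / k%:R.
have kN0 : (0 < k)%N by case: k jk {C CT Cc a} => //; case: j j1.
have k0 : (0 < k%:R :> R) by rewrite ltr0n.
have ak : a * k%:R = pi *+ 2 * j%:R by rewrite divfK// gt_eqF.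
have pi2 : 0 < pi *+ 2 :> R by rewrite pmulrn_lgt0// pi_gt0.
(* The bounds on [j] place [a] strictly between 0 and 2 pi. *)
have a1 : cos a != 1.
  rewrite lt_eqF// cos_lt1//; apply/andP; split.
    by rewrite divr_gt0// mulr_gt0// ltr0n.
  rewrite ltr_pdivrMr// ltr_pM2l// ltr_nat.
  by rewrite (leq_ltn_trans jk)// subn1 prednK.
have [lambda eig] := circulant_cos_eigen _ _ _ _ _ CT Cc ak.
exists lambda => psi u.
(* The lower half is the same wave with its phase shifted by [phi], so one [lambda] serves both
   halves. *)
have uE : u = col_mx (\col_l cos (a * l%:R + psi)) (\col_l cos (a * l%:R + (phi + psi))).
  rewrite /u /twisted_state map_col_mx.
  have E (l : 'I_k) : 2 * pi * l%:R * j%:R / k%:R = a * l%:R :> R.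
    by rewrite /a -mulr_natl; ring.
  by congr col_mx; apply/colP => l; rewrite !mxE E// addrA.
have C_eig x : C *m (\col_l cos (a * l%:R + x)) = lambda *: \col_l cos (a * l%:R + x).
  by apply/colP => l; rewrite !mxE -eig; apply: eq_bigr => m _; rewrite mxE.
have const_eig b x : const_mx b *m (\col_(l < k) cos (a * l%:R + x)) = 0 :> 'cV_k.
  apply/colP => l; rewrite !mxE -[RHS](mulr0 b) -[in RHS](sum_cos_eq0 _ _ _ _ x ak a1).
  by rewrite mulr_sumr; apply: eq_bigr => m _; rewrite !mxE.
by rewrite uE mul_block_col !C_eig !const_eig addr0 add0r scale_col_mx.
Qed.

(** * From real eigenvectors to equilibria *)

Lemma eigen_kuramoto_equilibrium (R : realType) (N : nat) (A : 'M[R]_N)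
    (theta : 'cV[R]_N) (lambda : R) :
  A *m map_mx cos theta = lambda *: map_mx cos theta ->
  A *m map_mx sin theta = lambda *: map_mx sin theta ->
  kuramoto_equilibrium A theta.
Proof.
move=> Acos Asin i.
have eig (f : R -> R) : A *m map_mx f theta = lambda *: map_mx f theta ->
    \sum_l A i l * f (theta l 0) = lambda * f (theta i 0).
  move=> /colP/(_ i); rewrite !mxE => <-.
  by apply: eq_bigr => l _; rewrite mxE.
transitivity ((\sum_l A i l * sin (theta l 0)) * cos (theta i 0) -
              (\sum_l A i l * cos (theta l 0)) * sin (theta i 0)).
  by rewrite !mulr_suml -sumrB; apply: eq_bigr => l _; rewrite sinB; ring.
by rewrite !eig//; ring.
Qed.

Lemma eigen_complex_kuramoto_equilibrium (R : realType) (N : nat)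
    (A : 'M[R]_N) (eps : R) (theta : 'cV[R]_N) (lambda : R) :
  A *m map_mx cos theta = lambda *: map_mx cos theta ->
  A *m map_mx sin theta = lambda *: map_mx sin theta ->
  complex_kuramoto_equilibrium A eps theta.
Proof.
move=> Acos Asin x0 t _ i.
have -> : x0 i 0 = cexpi (theta i 0) by rewrite mxE.
split; last exact: carg_cexpi.
set E := expmx _.
(* Since [E] is real, it acts separately on the real part [cos] and the imaginary part [sin]. *)
have eig (f : R -> R) : A *m map_mx f theta = lambda *: map_mx f theta ->
    \sum_l E i l * f (theta l 0) = expR (eps * t * lambda) * f (theta i 0).
  move=> Af.
  have := @expmx_eigen _ _ ((eps * t) *: A) (map_mx f theta) (eps * t * lambda).
  rewrite -scalemxAl Af scalerA => /(_ erefl) /colP/(_ i).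
  rewrite !mxE => <-.
  by apply: eq_bigr => l _; rewrite mxE.
(* The scaling factor is positive whatever the signs of [eps] and [lambda]. *)
rewrite -[RHS](@carg_scale _ (expR (eps * t * lambda))) ?expR_gt0//; congr carg.
transitivity ((\sum_l E i l * cos (theta l 0)) +i*
              (\sum_l E i l * sin (theta l 0)))%C.
  have -> (F G : 'I_N -> R) :
      ((\sum_l F l) +i* (\sum_l G l))%C = \sum_l (F l +i* G l)%C.
    by apply: (big_rec3 (fun a b c => (a +i* b)%C = c)) => // l x y _ _ <-.
  rewrite mxE; apply: eq_bigr => l _; rewrite !mxE /cexpi; apply/eqP.
  by rewrite eq_complex /= !mul0r subr0 addr0 !eqxx.
rewrite !eig//; apply/eqP; rewrite eq_complex /=.
by rewrite !mul0r subr0 addr0 !eqxx.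
Qed.

Theorem proposition12 (R : realType) (k : nat) (C : 'M[R]_k)
    (alpha beta eps : R) (j : nat) (phi : R) :
  C^T = C ->
  is_circulant C ->
  (1 <= j <= k - 1)%N ->
  0 <= phi < 2 * pi ->
  let A : 'M[R]_(k + k) :=
    block_mx C (const_mx alpha) (const_mx beta) C in
  let theta0 : 'cV[R]_(k + k) := twisted_state k j phi in
  complex_kuramoto_equilibrium A eps theta0 /\
  kuramoto_equilibrium A theta0.
Proof.
move=> CT Cc jk _ A theta.
have [lambda eig] := twisted_state_cos_eigen _ _ _ alpha beta _ phi CT Cc jk.
have Acos : A *m map_mx cos theta = lambda *: map_mx cos theta.
  have := eig 0; rewrite /= (_ : map_mx _ _ = map_mx cos theta)//.
  by apply/matrixP => i l; rewrite [LHS]mxE addr0 [RHS]mxE.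
have Asin : A *m map_mx sin theta = lambda *: map_mx sin theta.
  have := eig (- (pi / 2)); rewrite /= (_ : map_mx _ _ = map_mx sin theta)//.
  by apply/matrixP => i l; rewrite [LHS]mxE cosBpihalf [RHS]mxE.
split; first exact: eigen_complex_kuramoto_equilibrium Acos Asin.
exact: eigen_kuramoto_equilibrium Acos Asin.
Qed.
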